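(* For every $\ell\in\mathbb{N}_0$, the ratio $\frac{B_{2\ell}(s)}{B_{2\ell+1}(s)}$ decreases in $s\in\bigl(0,\frac12\bigr)$ and decreases in $s\in\bigl(\frac12,1\bigr)$. For each fixed $s\in\bigl(0,\frac12\bigr)$, the sequence $\frac{(2\ell+1)B_{2\ell}(s)}{B_{2\ell+1}(s)}$ increases in $\ell\in\mathbb{N}_0$; for each fixed $s\in\bigl(\frac12,1\bigr)$, the sequence $\frac{(2\ell+1)B_{2\ell}(s)}{B_{2\ell+1}(s)}$ decreases in $\ell\in\mathbb{N}_0$. Moreover, $$\lim_{\ell\to\infty}\frac{(2\ell+1)B_{2\ell}(s)}{B_{2\ell+1}(s)}=2\pi\cot(2\pi s),\qquad s\in(0,1)\setminus\Bigl\{\frac12\Bigr\}.$$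
   Context: $\mathbb{N}=\{1,2,\dots\}$ and $\mathbb{N}_0=\{0\}\cup\mathbb{N}$. The Bernoulli polynomials $B_\ell(s)$, $\ell\in\mathbb{N}_0$, are defined by $\frac{z e^{sz}}{e^z-1}=\sum_{\ell=0}^\infty B_\ell(s)\frac{z^\ell}{\ell!}$ for $|z|<2\pi$. *)

(* Defs.v *)
From Stdlib Require Import Reals Factorial.
From Coquelicot Require Import Coquelicot.
Open Scope R_scope.

(* [B l s] is the value at [s] of the Bernoulli polynomial of index [l].
   Real [z] are enough to determine the coefficients [B l s], so asking for the
   expansion at real points only is no restriction compared with complex [z].
   At [z = 0] the left-hand side is a removable singularity, hence [z <> 0]. *)
Definition is_bernoulli_polynomials (B : nat -> R -> R) : Prop :=
  forall s z : R, z <> 0 -> Rabs z < 2 * PI ->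
    is_series (fun l : nat => B l s * (z ^ l / INR (fact l)))
              (z * exp (s * z) / (exp z - 1)).

(* Not [/ tan x], whose meaning at the zeros of [cos] would depend on the
   value chosen for a division by zero. *)
Definition cot (x : R) : R := cos x / sin x.

Definition strictly_decreasing_on (f : R -> R) (a b : R) : Prop :=
  forall x y : R, a < x -> x < y -> y < b -> f y < f x.

Definition bernoulli_ratio (B : nat -> R -> R) (l : nat) (s : R) : R :=
  B (2 * l)%nat s / B (2 * l + 1)%nat s.

Definition scaled_bernoulli_ratio (B : nat -> R -> R) (s : R) (l : nat) : R :=
  INR (2 * l + 1) * B (2 * l)%nat s / B (2 * l + 1)%nat s.

(* Main.v *)
(* With b_n = B_n / n! one has b_n' = b_(n-1), so (2l+1) B_2l / B_(2l+1) is the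
   logarithmic derivative of b_(2l+1). The functions p_l = (-1)^(l+1) b_(2l+1)
   satisfy p_l'' = - p_(l-1) and, for l >= 1, vanish at 0 and 1/2; by concavity
   they are positive on (0, 1/2), which gives the monotonicity in s. Monotonicity
   in l is the positivity of the Wronskian of p_l and p_(l+1), which propagates by
   induction on l through a maximum principle. The same induction with
   sin (2 pi s), a fixed point of the recursion up to scaling, in place of p_(l+1)
   shows that p_l / sin (2 pi s) is decreasing. Its limits at 0 and 1/2 are
   b_2l(0) and - b_2l(1/2) = (1 - 2^(1-2l)) b_2l(0) up to a common factor, so
   p_l / b_2l(0) is squeezed to a multiple of sin (2 pi s), and after one
   integration p_l' to a multiple of cos (2 pi s). The interval (1/2, 1) follows
   from b_n(1 - s) = (-1)^n b_n(s). *)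
Require Import Defs.
From Stdlib Require Import Reals Lra Lia Factorial.
From Coquelicot Require Import Coquelicot.
Open Scope R_scope.

(** * Power series: uniqueness of coefficients and the exponential series *)

Lemma CV_radius_ge_abs (a : nat -> R) (z l : R) :
  is_pseries a z l -> Rbar_le (Rabs z) (CV_radius a).
Proof.
  intros H; apply Rbar_not_lt_le; intros Hlt.
  apply (CV_disk_outside a z Hlt), ex_series_lim_0.
  exists l; now apply is_pseries_R.
Qed.

Lemma CV_radius_gt_abs (a : nat -> R) (x z l : R) :
  is_pseries a z l -> Rabs x < Rabs z -> Rbar_lt (Rabs x) (CV_radius a).
Proof.
  intros H Hx; apply Rbar_lt_le_trans with (Rabs z); [exact Hx|].
  now apply CV_radius_ge_abs with l.
Qed.

(** Turns identities between generating functions into identities between Bernoulli polynomials. The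
    point [z = 0] is left out because the generating function is only prescribed away from it. *)
Lemma pseries_coef_unique (a b : nat -> R) (r : R) :
  0 < r ->
  (forall z, z <> 0 -> Rabs z < r ->
     exists l, is_pseries a z l /\ is_pseries b z l) ->
  forall n, a n = b n.
Proof.
  intros Hr H n.
  destruct (H (r / 2)) as [l [Ha Hb]]; [lra|rewrite Rabs_pos_eq; lra|].
  assert (E0 : Rabs 0 < Rabs (r / 2)) by (rewrite Rabs_R0, Rabs_pos_eq; lra).
  pose proof (CV_radius_gt_abs a 0 _ _ Ha E0) as Ra.
  pose proof (CV_radius_gt_abs b 0 _ _ Hb E0) as Rb.
  rewrite Rabs_R0 in Ra, Rb.
  (* Multiplying both series by [z] removes the missing point [z = 0]. *)
  change (PS_incr_1 a (S n) = PS_incr_1 b (S n)).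
  apply PSeries_ext_recip; rewrite ?CV_radius_incr_1; trivial.
  exists (mkposreal r Hr); intros z Hz.
  rewrite !PSeries_incr_1.
  destruct (Req_dec z 0) as [->|Hz0]; [ring|].
  destruct (H z Hz0) as [l' [Ha' Hb']].
  { change (Rabs (z - 0) < r) in Hz; now rewrite Rminus_0_r in Hz. }
  now rewrite (is_pseries_unique _ _ _ Ha'), (is_pseries_unique _ _ _ Hb').
Qed.

Lemma is_pseries_comp_scal (a : nat -> R) (c z l : R) :
  is_pseries a (c * z) l -> is_pseries (fun n => a n * c ^ n) z l.
Proof.
  intros H; apply is_pseries_R; apply is_pseries_R in H.
  eapply is_series_ext; [|exact H].
  intros n; simpl; rewrite Rpow_mult_distr; ring.
Qed.

Lemma is_pseries_exp_scal (s z : R) :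
  is_pseries (fun n => s ^ n / INR (fact n)) z (exp (s * z)).
Proof.
  pose proof (is_pseries_comp_scal _ s z _ (is_exp_Reals (s * z))) as H.
  apply is_pseries_R; apply is_pseries_R in H.
  eapply is_series_ext; [|exact H].
  intros n; unfold Rdiv; simpl; ring.
Qed.

Lemma exp_minus_1_neq_0 (z : R) : z <> 0 -> exp z - 1 <> 0.
Proof.
  intros Hz H; apply Hz, exp_inv; rewrite exp_0; lra.
Qed.

(** * Identities for b_n = B_n / n! read off from the generating function *)

Definition bern (B : nat -> R -> R) (n : nat) (s : R) : R := B n s / INR (fact n).

Lemma two_lt_2PI : 2 < 2 * PI.
Proof. pose proof PI2_1; lra. Qed.

Lemma bern_pseries (B : nat -> R -> R) (hB : is_bernoulli_polynomials B) (s z : R) :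
  z <> 0 -> Rabs z < 2 ->
  is_pseries (fun n => bern B n s) z (z * exp (s * z) / (exp z - 1)).
Proof.
  intros Hz Hz2; apply is_pseries_R.
  eapply is_series_ext; [|apply (hB s z Hz)].
  - intros n; unfold bern, Rdiv; simpl; ring.
  - pose proof two_lt_2PI; lra.
Qed.

(** Cauchy product for the factorization of the generating function into its value at [s = 0] times
    [exp (s * z)]. It exhibits b_n as a polynomial in [s], so no series has to be differentiated in
    [s]. *)
Lemma bern_addition (B : nat -> R -> R) (hB : is_bernoulli_polynomials B)
  (s : R) (n : nat) :
  bern B n s =
  sum_n (fun k => bern B k 0 * (s ^ (n - k) / INR (fact (n - k)))) n.
Proof.
  rewrite sum_n_Reals.
  revert n.
  (* Both factors converge at [z = 1], so [Rabs z < 1] lies strictly inside their disks of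
     convergence, as the Cauchy product requires. *)
  apply (pseries_coef_unique _
    (PS_mult (fun k => bern B k 0) (fun k => s ^ k / INR (fact k))) 1); [lra|].
  intros z Hz Hz1.
  exists (z * exp (s * z) / (exp z - 1)); split.
  - apply bern_pseries; trivial; lra.
  - assert (H1 : Rabs z < Rabs 1) by (rewrite Rabs_R1; lra).
    replace (z * exp (s * z) / (exp z - 1))
      with (z * exp (0 * z) / (exp z - 1) * exp (s * z)).
    + apply is_pseries_mult.
      * apply bern_pseries; trivial; lra.
      * apply is_pseries_exp_scal.
      * eapply CV_radius_gt_abs; [|exact H1].
        apply (bern_pseries B hB); [lra|rewrite Rabs_R1; lra].
      * eapply CV_radius_gt_abs; [apply is_pseries_exp_scal|exact H1].
    + rewrite Rmult_0_l, exp_0; field; now apply exp_minus_1_neq_0.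
Qed.

Lemma is_derive_pow_div_fact (n : nat) (x : R) :
  is_derive (fun x => x ^ S n / INR (fact (S n))) x (x ^ n / INR (fact n)).
Proof.
  auto_derive; trivial.
  change (fact n + n * fact n)%nat with (S n * fact n)%nat.
  simpl Nat.pred; change (match n with 0%nat => 1 | S _ => INR n + 1 end) with (INR (S n)).
  rewrite mult_INR; field; split; [apply INR_fact_neq_0|apply not_0_INR; lia].
Qed.

Lemma bern_derive (B : nat -> R -> R) (hB : is_bernoulli_polynomials B)
  (n : nat) (x : R) :
  is_derive (bern B (S n)) x (bern B n x).
Proof.
  (* The summand [k = S n] is constant in [y] and is split off; in the others [S n - k] becomes
     [S (n - k)], ready for the power rule. *)
  apply is_derive_ext with
    (f := fun y => sum_n (fun k => bern B k 0 *
                     (y ^ S (n - k) / INR (fact (S (n - k))))) n + bern B (S n) 0).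
  { intros y; symmetry; rewrite (bern_addition B hB y (S n)), sum_Sn.
    change plus with Rplus; rewrite Nat.sub_diag; simpl (_ / INR (fact 0)).
    f_equal; [|simpl; field].
    apply sum_n_ext_loc; intros k Hk.
    now replace (S n - k)%nat with (S (n - k)) by lia. }
  rewrite (bern_addition B hB x n).
  replace (sum_n _ n) with (plus (sum_n (fun k => bern B k 0 *
     (x ^ (n - k) / INR (fact (n - k)))) n) 0) by apply Rplus_0_r.
  apply (is_derive_plus (V := R_NormedModule)); [|apply (is_derive_const (V := R_NormedModule))].
  apply (is_derive_sum_n (V := R_NormedModule)
     (fun k y => bern B k 0 * (y ^ S (n - k) / INR (fact (S (n - k)))))).
  intros k _; apply is_derive_scal, is_derive_pow_div_fact.
Qed.

Lemma bern_0 (B : nat -> R -> R) (hB : is_bernoulli_polynomials B) (s : R) :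
  bern B 0 s = bern B 0 0.
Proof.
  rewrite (bern_addition B hB s 0), sum_O; simpl; field.
Qed.

(** The generating function is unchanged when [(s, z)] is replaced by [(1 - s, - z)]. *)
Lemma bern_symm (B : nat -> R -> R) (hB : is_bernoulli_polynomials B)
  (s : R) (n : nat) :
  bern B n (1 - s) = (-1) ^ n * bern B n s.
Proof.
  rewrite Rmult_comm; revert n.
  apply (pseries_coef_unique _ (fun n => bern B n s * (-1) ^ n) 2); [lra|].
  intros z Hz Hz2; exists (z * exp ((1 - s) * z) / (exp z - 1)); split.
  { now apply bern_pseries. }
  apply is_pseries_comp_scal.
  replace (z * exp ((1 - s) * z) / (exp z - 1))
    with ((-1 * z) * exp (s * (-1 * z)) / (exp (-1 * z) - 1)).
  - apply bern_pseries; trivial; [lra|].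
    rewrite Rabs_mult, Rabs_m1; lra.
  - replace ((1 - s) * z) with (z + s * (-1 * z)) by ring.
    replace (exp (-1 * z)) with (/ exp z) by (rewrite <- exp_Ropp; f_equal; ring).
    rewrite exp_plus; pose proof (exp_pos z); pose proof (exp_minus_1_neq_0 z Hz).
    field; repeat split; lra.
Qed.

(** With w = e^(z/2), it comes from z w / (w^2 - 1) = 2 (z/2) / (w - 1) - z / (w^2 - 1). *)
Lemma bern_half (B : nat -> R -> R) (hB : is_bernoulli_polynomials B) (n : nat) :
  bern B n (1 / 2) = (2 * (1 / 2) ^ n - 1) * bern B n 0.
Proof.
  rewrite Rmult_comm; revert n.
  apply (pseries_coef_unique _
    (fun n => bern B n 0 * (2 * (1 / 2) ^ n - 1)) 2); [lra|].
  intros z Hz Hz2; exists (z * exp (1 / 2 * z) / (exp z - 1)); split.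
  { now apply bern_pseries. }
  assert (H1 := bern_pseries B hB 0 z Hz Hz2).
  assert (H2 : is_pseries (fun n => bern B n 0 * (1 / 2) ^ n) z
     ((1 / 2 * z) * exp (0 * (1 / 2 * z)) / (exp (1 / 2 * z) - 1))).
  { apply is_pseries_comp_scal, bern_pseries; trivial; [lra|].
    rewrite Rabs_mult, (Rabs_pos_eq (1 / 2)); [pose proof (Rabs_pos z); lra|lra]. }
  apply is_pseries_R; apply is_pseries_R in H1; apply is_pseries_R in H2.
  pose proof (is_series_minus _ _ _ _ (is_series_scal 2 _ _ H2) H1) as H3.
  match type of H3 with is_series _ ?l => replace (z * exp (1 / 2 * z) / (exp z - 1)) with l end.
  - eapply is_series_ext; [|exact H3].
    intros n; unfold minus, plus, opp, scal; simpl; unfold mult; simpl; ring.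
  - unfold minus, plus, opp, scal; simpl; unfold mult; simpl.
    rewrite !Rmult_0_l, !exp_0.
    assert (H4 : exp z = exp (1 / 2 * z) * exp (1 / 2 * z)).
    { rewrite <- exp_plus; f_equal; field. }
    pose proof (exp_minus_1_neq_0 z Hz) as H5.
    assert (H6 := exp_minus_1_neq_0 (1 / 2 * z) ltac:(lra)).
    pose proof (exp_pos (1 / 2 * z)).
    rewrite H4 in *; field; lra.
Qed.

(** The generating functions at [s = 1] and [s = 0] differ by exactly [z]. *)
Lemma bern_period (B : nat -> R -> R) (hB : is_bernoulli_polynomials B) (n : nat) :
  bern B n 1 - bern B n 0 = if Nat.eq_dec n 1 then 1 else 0.
Proof.
  revert n.
  apply (pseries_coef_unique _ (fun n => if Nat.eq_dec n 1 then 1 else 0) 2); [lra|].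
  intros z Hz Hz2; exists z; split.
  - assert (H0 := bern_pseries B hB 0 z Hz Hz2).
    assert (H1 := bern_pseries B hB 1 z Hz Hz2).
    pose proof (is_pseries_minus _ _ _ _ _ H1 H0) as H.
    match type of H with is_pseries _ _ ?l => replace z with l at 2 end.
    + exact H.
    + unfold minus, plus, opp; simpl.
      rewrite Rmult_0_l, Rmult_1_l, exp_0; field; now apply exp_minus_1_neq_0.
  - apply is_pseries_R.
    apply is_series_decr_1, is_series_decr_1.
    replace (plus _ _) with (zero : R)
     by (unfold plus, zero, opp; simpl; ring).
    apply is_series_ext with (fun _ => 0); [intros n; simpl; ring|].
    apply filterlim_ext with (fun _ => 0); [|apply filterlim_const].
    intros n; rewrite sum_n_const; ring.
Qed.

(** By the addition formula b_1(1) - b_1(0) = b_0(0), and [bern_period] gives 1 for the left side;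
    the generating function is never evaluated at its singularity. *)
Lemma bern_0_eq_1 (B : nat -> R -> R) (hB : is_bernoulli_polynomials B) (s : R) :
  bern B 0 s = 1.
Proof.
  rewrite bern_0 by assumption.
  pose proof (bern_period B hB 1) as H; simpl in H.
  rewrite (bern_addition B hB 1 1), sum_Sn, sum_O in H.
  change plus with Rplus in H; simpl in H; lra.
Qed.

Lemma bern_odd_half (B : nat -> R -> R) (hB : is_bernoulli_polynomials B) (l : nat) :
  bern B (2 * l + 1) (1 / 2) = 0.
Proof.
  pose proof (bern_symm B hB (1 / 2) (2 * l + 1)) as H.
  rewrite pow_add, pow_1_even in H; replace (1 - 1 / 2) with (1 / 2) in H by lra; lra.
Qed.

(** Symmetry gives b(1) = - b(0), and periodicity gives b(1) = b(0). Index 1 must be excluded, since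
    b_1(0) = - 1/2. *)
Lemma bern_odd_0 (B : nat -> R -> R) (hB : is_bernoulli_polynomials B) (l : nat) :
  bern B (2 * S l + 1) 0 = 0.
Proof.
  pose proof (bern_symm B hB 0 (2 * S l + 1)) as H.
  pose proof (bern_period B hB (2 * S l + 1)) as H1.
  destruct (Nat.eq_dec (2 * S l + 1) 1); [lia|].
  rewrite pow_add, pow_1_even, Rminus_0_r in H; lra.
Qed.

(** * Calculus: signs of derivatives, concavity and a maximum principle *)

Lemma is_derive_mvt (f df : R -> R) (a b : R) :
  a < b -> (forall x, a <= x <= b -> is_derive f x (df x)) ->
  exists c, a < c < b /\ f b - f a = df c * (b - a).
Proof.
  intros Hab H.
  destruct (MVT_cor2 f df a b Hab) as [c [E Hc]].
  - intros c Hc; now apply is_derive_Reals, H.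
  - now exists c.
Qed.

Lemma is_derive_neg_lt (f df : R -> R) (a b : R) :
  a < b -> (forall x, a <= x <= b -> is_derive f x (df x)) ->
  (forall x, a < x < b -> df x < 0) -> f b < f a.
Proof.
  intros Hab H Hneg.
  destruct (is_derive_mvt f df a b Hab H) as [c [Hc E]].
  specialize (Hneg c Hc); nra.
Qed.

Lemma is_derive_nonpos_le (f df : R -> R) (a b : R) :
  a < b -> (forall x, a <= x <= b -> is_derive f x (df x)) ->
  (forall x, a < x < b -> df x <= 0) -> f b <= f a.
Proof.
  intros Hab H Hneg.
  destruct (is_derive_mvt f df a b Hab H) as [c [Hc E]].
  specialize (Hneg c Hc); nra.
Qed.

Lemma is_derive_neg_right (f : R -> R) (x d : R) :
  is_derive f x d -> d < 0 ->
  exists delta, 0 < delta /\ forall y, x < y < x + delta -> f y < f x.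
Proof.
  intros H Hd; apply is_derive_Reals in H.
  destruct (H (- d)) as [delta Hdelta]; [lra|].
  exists delta; split; [apply cond_pos|].
  intros y Hy.
  specialize (Hdelta (y - x) ltac:(lra)).
  rewrite Rabs_pos_eq in Hdelta by lra.
  specialize (Hdelta ltac:(lra)); apply Rabs_def2 in Hdelta.
  replace (x + (y - x)) with y in Hdelta by ring.
  assert (E : (f y - f x) / (y - x) < 0) by lra.
  assert (E2 : f y - f x = (f y - f x) / (y - x) * (y - x)) by (field; lra).
  nra.
Qed.

(** Serves twice: for the vanishing of the derivative at an interior minimum, and, in place of
    l'Hopital's rule, for comparing two functions that vanish at the same endpoint. *)
Lemma is_derive_ge_0_right (f : R -> R) (a b d : R) :
  a < b -> is_derive f a d -> f a = 0 ->
  (forall x, a < x < b -> 0 <= f x) -> 0 <= d.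
Proof.
  intros Hab H Ha Hf; apply Rnot_lt_le; intros Hd.
  destruct (is_derive_neg_right f a d H Hd) as [delta [Hdelta Hlt]].
  assert (He : 0 < Rmin delta (b - a)) by (apply Rmin_pos; lra).
  pose proof (Rmin_l delta (b - a)); pose proof (Rmin_r delta (b - a)).
  set (e := Rmin delta (b - a)) in *.
  specialize (Hlt (a + e / 2) ltac:(lra)).
  specialize (Hf (a + e / 2) ltac:(lra)); lra.
Qed.

Lemma is_derive_reflect (f df : R -> R) (x : R) :
  is_derive f (- x) (df (- x)) -> is_derive (fun y => f (- y)) x (- df (- x)).
Proof.
  intros H.
  replace (- df (- x)) with (scal (-1) (df (- x)))
    by (unfold scal; simpl; unfold mult; simpl; ring).
  apply (is_derive_comp f Ropp x); [exact H|].
  auto_derive; trivial; ring.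
Qed.

Lemma is_derive_le_0_left (f : R -> R) (a b d : R) :
  a < b -> is_derive f b d -> f b = 0 ->
  (forall x, a < x < b -> 0 <= f x) -> d <= 0.
Proof.
  intros Hab H Hb Hf.
  enough (0 <= - d) by lra.
  apply (is_derive_ge_0_right (fun y => f (- y)) (- b) (- a)).
  - lra.
  - apply (is_derive_reflect f (fun _ => d)); now rewrite Ropp_involutive.
  - now rewrite Ropp_involutive.
  - intros x Hx; apply Hf; lra.
Qed.

Lemma second_derivative_neg_right (f df : R -> R) (x b c : R) :
  x < b -> (forall y, x <= y <= b -> is_derive f y (df y)) ->
  df x = 0 -> is_derive df x c -> c < 0 ->
  exists y, x < y < b /\ f y < f x.
Proof.
  intros Hxb H H0 Hc Hneg.
  destruct (is_derive_neg_right df x c Hc Hneg) as [delta [Hdelta Hlt]].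
  assert (He : 0 < Rmin delta (b - x)) by (apply Rmin_pos; lra).
  pose proof (Rmin_l delta (b - x)); pose proof (Rmin_r delta (b - x)).
  set (e := Rmin delta (b - x)) in *.
  exists (x + e / 2); split; [lra|].
  apply is_derive_neg_lt with df; [lra| |].
  - intros y Hy; apply H; lra.
  - intros y Hy; rewrite <- H0; apply Hlt; lra.
Qed.

(** A value [f x <= 0] would force a slope [<= 0] somewhere on [(a, x)] and a slope [>= 0] somewhere
    on [(x, b)], while [f'] strictly decreases. *)
Lemma concave_pos (f f' F : R -> R) (a b : R) :
  (forall x, a <= x <= b -> is_derive f x (f' x)) ->
  (forall x, a <= x <= b -> is_derive f' x (- F x)) ->
  (forall x, a < x < b -> 0 < F x) ->
  f a = 0 -> f b = 0 ->
  forall x, a < x < b -> 0 < f x.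
Proof.
  intros Hf Hf' HF Ha Hb x Hx; apply Rnot_le_lt; intros Hle.
  destruct (is_derive_mvt f f' a x) as [c [Hc Ec]]; [lra| |].
  { intros y Hy; apply Hf; lra. }
  destruct (is_derive_mvt f f' x b) as [c' [Hc' Ec']]; [lra| |].
  { intros y Hy; apply Hf; lra. }
  assert (f' c' < f' c).
  { apply is_derive_neg_lt with (fun y => - F y); [lra| |].
    - intros y Hy; apply Hf'; lra.
    - intros y Hy; specialize (HF y ltac:(lra)); lra. }
  assert (f' c <= 0) by nra.
  assert (0 <= f' c') by nra.
  lra.
Qed.

(* A maximum principle for the Wronskian [W = g' f - g f']: at an interior
   minimum with [W <= 0], [W' = g F - G f = 0] turns [W''] into
   [- (f / F) (G' F - G F') + (F / f) W < 0]. *)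
Lemma wronskian_pos (f f' F F' g g' G G' : R -> R) (a b : R) :
  (forall x, a <= x <= b -> is_derive f x (f' x)) ->
  (forall x, a <= x <= b -> is_derive f' x (- F x)) ->
  (forall x, a <= x <= b -> is_derive F x (F' x)) ->
  (forall x, a <= x <= b -> is_derive g x (g' x)) ->
  (forall x, a <= x <= b -> is_derive g' x (- G x)) ->
  (forall x, a <= x <= b -> is_derive G x (G' x)) ->
  f a = 0 -> f b = 0 -> g a = 0 -> g b = 0 ->
  (forall x, a < x < b -> 0 < f x) ->
  (forall x, a < x < b -> 0 < F x) ->
  (forall x, a < x < b -> 0 < G' x * F x - G x * F' x) ->
  forall x, a < x < b -> 0 < g' x * f x - g x * f' x.
Proof.
  intros Hf Hf' HF Hg Hg' HG fa fb ga gb f_pos F_pos HGF x0 Hx0.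
  pose (W := fun x => g' x * f x - g x * f' x).
  pose (W' := fun x => g x * F x - G x * f x).
  assert (HW : forall x, a <= x <= b -> is_derive W x (W' x)).
  { intros x Hx.
    replace (W' x) with
      (minus (plus (mult (- G x) (f x)) (mult (g' x) (f' x)))
             (plus (mult (g' x) (f' x)) (mult (g x) (- F x))))
      by (unfold W', minus, plus, opp, mult; simpl; ring).
    apply (is_derive_minus (V := R_NormedModule));
      apply (is_derive_mult (K := R_AbsRing)); auto; intros; apply Rmult_comm. }
  assert (HW' : forall x, a <= x <= b -> is_derive W' x
     (g' x * F x + g x * F' x - (G' x * f x + G x * f' x))).
  { intros x Hx.
    apply (is_derive_minus (V := R_NormedModule));
      apply (is_derive_mult (K := R_AbsRing)); auto; intros; apply Rmult_comm. }
  apply Rnot_le_lt; intros Hle; change (W x0 <= 0) in Hle.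
  (* A negative minimum is interior because [W] vanishes at both ends. Otherwise [W >= 0]
     throughout, and [x0] itself is a minimum. *)
  assert (Hmin : exists x, a < x < b /\ W x <= 0 /\
                   forall y, a <= y <= b -> W x <= W y).
  { destruct (continuity_ab_min W a b) as [m [Hm Hab]]; [lra| |].
    { intros c Hc; apply derivable_continuous_pt.
      exists (W' c); now apply is_derive_Reals, HW. }
    assert (Wa : W a = 0) by (unfold W; rewrite fa, ga; ring).
    assert (Wb : W b = 0) by (unfold W; rewrite fb, gb; ring).
    destruct (Rlt_le_dec (W m) 0) as [Hneg|Hpos].
    - exists m; repeat split; trivial; try lra.
      + destruct (Req_dec m a) as [->|]; lra.
      + destruct (Req_dec m b) as [->|]; lra.
    - exists x0; repeat split; try lra.
      intros y Hy; specialize (Hm y Hy); lra. }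
  destruct Hmin as [x [Hx [Wx Hmin]]].
  assert (W'0 : W' x = 0).
  { apply Rle_antisym.
    - apply (is_derive_le_0_left (fun y => W y - W x) a x); [lra| |ring|].
      + replace (W' x) with (minus (W' x) 0) by (unfold minus, plus, opp; simpl; ring).
        apply (is_derive_minus (V := R_NormedModule)); [apply HW; lra|].
        apply (is_derive_const (V := R_NormedModule)).
      + intros y Hy; specialize (Hmin y ltac:(lra)); lra.
    - apply (is_derive_ge_0_right (fun y => W y - W x) x b); [lra| |ring|].
      + replace (W' x) with (minus (W' x) 0) by (unfold minus, plus, opp; simpl; ring).
        apply (is_derive_minus (V := R_NormedModule)); [apply HW; lra|].
        apply (is_derive_const (V := R_NormedModule)).
      + intros y Hy; specialize (Hmin y ltac:(lra)); lra. }
  destruct (second_derivative_neg_right W W' x b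
     (g' x * F x + g x * F' x - (G' x * f x + G x * f' x)))
     as [y [Hy Hlt]]; trivial; try lra.
  - intros y Hy; apply HW; lra.
  - apply HW'; lra.
  - specialize (f_pos x Hx); specialize (F_pos x Hx); specialize (HGF x Hx).
    unfold W', W in *.
    assert (Eg : g x = G x * f x / F x) by (apply Rmult_eq_reg_r with (F x); [field_simplify|]; lra).
    replace (g' x * F x + g x * F' x - (G' x * f x + G x * f' x)) with
      (- (f x / F x * (G' x * F x - G x * F' x))
       + F x / f x * (g' x * f x - g x * f' x)) by (rewrite Eg; field; lra).
    assert (0 < f x / F x) by now apply Rdiv_lt_0_compat.
    assert (0 < F x / f x) by now apply Rdiv_lt_0_compat.
    nra.
  - specialize (Hmin y ltac:(lra)); lra.
Qed.

(** * The functions p_l: positivity and Wronskians of neighbours *)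

Definition odd_bern (B : nat -> R -> R) (l : nat) (s : R) : R :=
  (-1) ^ S l * bern B (2 * l + 1) s.

(** With the same sign as in [odd_bern B l], which is p_l, this is the derivative p_l'. *)
Definition even_bern (B : nat -> R -> R) (l : nat) (s : R) : R :=
  (-1) ^ S l * bern B (2 * l) s.

Lemma odd_bern_derive (B : nat -> R -> R) (hB : is_bernoulli_polynomials B)
  (l : nat) (s : R) :
  is_derive (odd_bern B l) s (even_bern B l s).
Proof.
  unfold odd_bern, even_bern; rewrite Nat.add_1_r.
  now apply is_derive_scal, bern_derive.
Qed.

Lemma even_bern_derive (B : nat -> R -> R) (hB : is_bernoulli_polynomials B)
  (l : nat) (s : R) :
  is_derive (even_bern B (S l)) s (- odd_bern B l s).
Proof.
  unfold odd_bern, even_bern.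
  replace (- ((-1) ^ S l * bern B (2 * l + 1) s))
    with ((-1) ^ S (S l) * bern B (2 * l + 1) s) by (simpl; ring).
  replace (2 * S l)%nat with (S (2 * l + 1)) by lia.
  now apply is_derive_scal, bern_derive.
Qed.

Lemma even_bern_0 (B : nat -> R -> R) (hB : is_bernoulli_polynomials B) (s : R) :
  even_bern B 0 s = - 1.
Proof.
  unfold even_bern; simpl (2 * 0)%nat.
  rewrite bern_0_eq_1 by assumption; simpl; ring.
Qed.

Lemma odd_bern_at_half (B : nat -> R -> R) (hB : is_bernoulli_polynomials B) (l : nat) :
  odd_bern B l (1 / 2) = 0.
Proof. unfold odd_bern; rewrite bern_odd_half by assumption; ring. Qed.

Lemma odd_bern_at_0 (B : nat -> R -> R) (hB : is_bernoulli_polynomials B) (l : nat) :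
  odd_bern B (S l) 0 = 0.
Proof. unfold odd_bern; rewrite bern_odd_0 by assumption; ring. Qed.

Lemma odd_bern_symm (B : nat -> R -> R) (hB : is_bernoulli_polynomials B)
  (l : nat) (s : R) :
  odd_bern B l (1 - s) = - odd_bern B l s.
Proof.
  unfold odd_bern; rewrite bern_symm by assumption.
  rewrite (pow_add (-1) (2 * l) 1), pow_1_even; ring.
Qed.

Lemma even_bern_symm (B : nat -> R -> R) (hB : is_bernoulli_polynomials B)
  (l : nat) (s : R) :
  even_bern B l (1 - s) = even_bern B l s.
Proof.
  unfold even_bern; rewrite bern_symm by assumption.
  rewrite pow_1_even; ring.
Qed.

(** The factor tends to 1, so the bounds of p_l / sin (2 pi s) coming from the two endpoints merge
    as [l] grows. *)
Lemma even_bern_at_half (B : nat -> R -> R) (hB : is_bernoulli_polynomials B) (l : nat) :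
  even_bern B l (1 / 2) = - ((1 - 2 * (1 / 4) ^ l) * even_bern B l 0).
Proof.
  unfold even_bern; rewrite bern_half, pow_mult by assumption.
  replace ((1 / 2) ^ 2) with (1 / 4) by (simpl; field); ring.
Qed.

Lemma odd_bern_pos (B : nat -> R -> R) (hB : is_bernoulli_polynomials B) (l : nat) :
  forall s, 0 < s < 1 / 2 -> 0 < odd_bern B l s.
Proof.
  induction l as [|l IH]; intros s Hs.
  (* p_0(s) = 1/2 - s does not vanish at 0, so concavity is replaced by its decrease to 0 at 1/2. *)
  - rewrite <- (odd_bern_at_half B hB 0).
    apply is_derive_neg_lt with (even_bern B 0); [lra| |].
    + intros x _; now apply odd_bern_derive.
    + intros x _; rewrite even_bern_0 by assumption; lra.
  - apply (concave_pos _ (even_bern B (S l)) (odd_bern B l) 0 (1 / 2)); trivial.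
    + intros x _; now apply odd_bern_derive.
    + intros x _; now apply even_bern_derive.
    + now apply odd_bern_at_0.
    + now apply odd_bern_at_half.
Qed.

Lemma odd_bern_wronskian_pos (B : nat -> R -> R) (hB : is_bernoulli_polynomials B)
  (l : nat) :
  forall s, 0 < s < 1 / 2 ->
  0 < even_bern B (S l) s * odd_bern B l s - odd_bern B (S l) s * even_bern B l s.
Proof.
  induction l as [|l IH].
  - intros s Hs.
    (* Since p_0(0) is not 0, the maximum principle does not cover this case. As p_0' = -1, the
       Wronskian is p_1' p_0 + p_1, with derivative - p_0^2 and value 0 at 1/2. *)
    pose (W := fun s => even_bern B 1 s * odd_bern B 0 s + odd_bern B 1 s).
    replace (even_bern B 1 s * _ - _) with (W s)
      by (unfold W; rewrite even_bern_0 by assumption; ring).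
    replace 0 with (W (1 / 2))
      by (unfold W; rewrite !odd_bern_at_half by assumption; ring).
    apply is_derive_neg_lt with (fun s => - (odd_bern B 0 s) ^ 2); [lra| |].
    + intros x _; unfold W.
      replace (- odd_bern B 0 x ^ 2) with
        (plus (plus (mult (- odd_bern B 0 x) (odd_bern B 0 x))
                 (mult (even_bern B 1 x) (even_bern B 0 x)))
           (even_bern B 1 x))
        by (rewrite even_bern_0 by assumption; unfold plus, mult; simpl; ring).
      apply (is_derive_plus (V := R_NormedModule)); [|now apply odd_bern_derive].
      apply (is_derive_mult (K := R_AbsRing)).
      * now apply even_bern_derive.
      * now apply odd_bern_derive.
      * intros; apply Rmult_comm.
    + intros x Hx; pose proof (odd_bern_pos B hB 0 x ltac:(lra)); nra.
  - apply (wronskian_pos _ _ (odd_bern B l) (even_bern B l)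
             _ _ (odd_bern B (S l)) (even_bern B (S l)));
      try (now intros; apply odd_bern_derive);
      try (now intros; apply even_bern_derive);
      try (now apply odd_bern_at_0); try (now apply odd_bern_at_half);
      try (now apply odd_bern_pos).
    exact IH.
Qed.

(** * Comparison of p_l with sin (2 pi s) and of p_l' with cos (2 pi s) *)

Lemma is_derive_sin_2PI (s : R) :
  is_derive (fun s => sin (2 * PI * s)) s (2 * PI * cos (2 * PI * s)).
Proof. auto_derive; trivial; ring. Qed.

Lemma is_derive_cos_2PI (s : R) :
  is_derive (fun s => 2 * PI * cos (2 * PI * s)) s
    (- ((2 * PI) ^ 2 * sin (2 * PI * s))).
Proof. auto_derive; trivial; ring. Qed.

Lemma sin_2PI_pos (s : R) : 0 < s < 1 / 2 -> 0 < sin (2 * PI * s).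
Proof.
  intros Hs; pose proof PI_RGT_0; apply sin_gt_0; nra.
Qed.

Lemma sin_2PI_half : sin (2 * PI * (1 / 2)) = 0.
Proof. replace (2 * PI * (1 / 2)) with PI by field; apply sin_PI. Qed.

Lemma cos_2PI_half : cos (2 * PI * (1 / 2)) = -1.
Proof. replace (2 * PI * (1 / 2)) with PI by field; apply cos_PI. Qed.

Lemma sin_odd_bern_wronskian_pos (B : nat -> R -> R)
  (hB : is_bernoulli_polynomials B) (l : nat) :
  forall s, 0 < s < 1 / 2 ->
  0 < 2 * PI * cos (2 * PI * s) * odd_bern B l s - sin (2 * PI * s) * even_bern B l s.
Proof.
  pose proof PI_RGT_0 as HPI.
  induction l as [|l IH].
  - intros s Hs.
    (* As p_0' = -1, the two cosine terms cancel in [W'], leaving - (2 pi)^2 sin (2 pi s) p_0(s),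
       and [W] vanishes at 1/2. *)
    pose (W := fun s => 2 * PI * cos (2 * PI * s) * odd_bern B 0 s + sin (2 * PI * s)).
    replace (_ - _) with (W s)
      by (unfold W; rewrite even_bern_0 by assumption; ring).
    replace 0 with (W (1 / 2))
      by (unfold W; rewrite odd_bern_at_half, sin_2PI_half by assumption; ring).
    apply is_derive_neg_lt with
      (fun s => - ((2 * PI) ^ 2 * sin (2 * PI * s) * odd_bern B 0 s)); [lra| |].
    + intros x _; unfold W.
      replace (- ((2 * PI) ^ 2 * sin (2 * PI * x) * odd_bern B 0 x)) with
        (plus (plus (mult (- ((2 * PI) ^ 2 * sin (2 * PI * x))) (odd_bern B 0 x))
                 (mult (2 * PI * cos (2 * PI * x)) (even_bern B 0 x)))
           (2 * PI * cos (2 * PI * x)))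
        by (rewrite even_bern_0 by assumption; unfold plus, mult; simpl; ring).
      apply (is_derive_plus (V := R_NormedModule)); [|apply is_derive_sin_2PI].
      apply (is_derive_mult (K := R_AbsRing) (fun s => 2 * PI * cos (2 * PI * s))).
      * apply is_derive_cos_2PI.
      * now apply odd_bern_derive.
      * intros; apply Rmult_comm.
    + intros x Hx.
      pose proof (odd_bern_pos B hB 0 x ltac:(lra)).
      pose proof (sin_2PI_pos x ltac:(lra)).
      assert (0 < (2 * PI) ^ 2) by (apply pow_lt; lra).
      assert (0 < (2 * PI) ^ 2 * sin (2 * PI * x)) by now apply Rmult_lt_0_compat.
      nra.
  (* Here [g] is the sine and [G = - g''] is (2 pi)^2 times the same sine, so the required lower
     Wronskian is (2 pi)^2 times that of the induction hypothesis. *)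
  - apply (wronskian_pos (odd_bern B (S l)) (even_bern B (S l))
             (odd_bern B l) (even_bern B l)
             (fun s => sin (2 * PI * s)) (fun s => 2 * PI * cos (2 * PI * s))
             (fun s => (2 * PI) ^ 2 * sin (2 * PI * s))
             (fun s => (2 * PI) ^ 2 * (2 * PI * cos (2 * PI * s))));
      try (now intros; apply odd_bern_derive);
      try (now intros; apply even_bern_derive);
      try (now apply odd_bern_at_0); try (now apply odd_bern_at_half);
      try (now apply odd_bern_pos).
    + intros; apply is_derive_sin_2PI.
    + intros; apply is_derive_cos_2PI.
    + intros; apply is_derive_scal, is_derive_sin_2PI.
    + now rewrite Rmult_0_r, sin_0.
    + apply sin_2PI_half.
    + intros x Hx.
      replace (_ - _) with ((2 * PI) ^ 2 *
        (2 * PI * cos (2 * PI * x) * odd_bern B l x - sin (2 * PI * x) * even_bern B l x))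
        by ring.
      apply Rmult_lt_0_compat; [apply pow_lt; lra|now apply IH].
Qed.

(** The derivative of p_l / sin is minus the Wronskian over sin^2. Clearing denominators gives an
    expression that stays differentiable at 0 and 1/2, where the sine vanishes. *)
Lemma odd_bern_div_sin_decr (B : nat -> R -> R) (hB : is_bernoulli_polynomials B)
  (l : nat) (x y : R) :
  0 < x -> x < y -> y < 1 / 2 ->
  odd_bern B l y * sin (2 * PI * x) < odd_bern B l x * sin (2 * PI * y).
Proof.
  intros Hx Hxy Hy.
  pose proof (sin_2PI_pos x ltac:(lra)) as Sx.
  pose proof (sin_2PI_pos y ltac:(lra)) as Sy.
  assert (H : odd_bern B l y / sin (2 * PI * y) < odd_bern B l x / sin (2 * PI * x)).
  { apply (is_derive_neg_lt (fun s => odd_bern B l s / sin (2 * PI * s))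
      (fun s => (even_bern B l s * sin (2 * PI * s)
                 - odd_bern B l s * (2 * PI * cos (2 * PI * s))) / sin (2 * PI * s) ^ 2));
      trivial.
    - intros s Hs; pose proof (sin_2PI_pos s ltac:(lra)).
      apply (is_derive_div _ (fun s => sin (2 * PI * s)));
        [now apply odd_bern_derive|apply is_derive_sin_2PI|lra].
    - intros s Hs; pose proof (sin_2PI_pos s ltac:(lra)).
      pose proof (sin_odd_bern_wronskian_pos B hB l s ltac:(lra)).
      apply Rdiv_neg_pos; [lra|now apply pow_lt]. }
  apply Rmult_lt_compat_r with (r := sin (2 * PI * x) * sin (2 * PI * y)) in H;
    [|now apply Rmult_lt_0_compat].
  replace (odd_bern B l y / _ * _) with (odd_bern B l y * sin (2 * PI * x)) in H by (field; lra).
  replace (odd_bern B l x / _ * _) with (odd_bern B l x * sin (2 * PI * y)) in H by (field; lra).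
  exact H.
Qed.

(** A decreasing quotient stays below its limit p'(0) / (2 pi) at 0. The index is [S l] because the
    limit needs p(0) = 0. *)
Lemma odd_bern_upper (B : nat -> R -> R) (hB : is_bernoulli_polynomials B)
  (l : nat) (s : R) :
  0 < s < 1 / 2 ->
  2 * PI * odd_bern B (S l) s <= even_bern B (S l) 0 * sin (2 * PI * s).
Proof.
  intros Hs.
  (* [phi] vanishes at 0 and is nonnegative on [(0, s)]; the claim is [phi' 0 >= 0]. *)
  pose (phi := fun y => sin (2 * PI * s) * odd_bern B (S l) y
                        - odd_bern B (S l) s * sin (2 * PI * y)).
  enough (0 <= sin (2 * PI * s) * even_bern B (S l) 0
               - odd_bern B (S l) s * (2 * PI * cos (2 * PI * 0))) as H.
  { rewrite Rmult_0_r, cos_0 in H; lra. }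
  apply (is_derive_ge_0_right phi 0 s); [lra| | |].
  - apply (is_derive_minus (V := R_NormedModule)); apply is_derive_scal.
    + now apply odd_bern_derive.
    + apply is_derive_sin_2PI.
  - unfold phi; rewrite odd_bern_at_0, Rmult_0_r, (Rmult_0_r (2 * PI)), sin_0 by assumption.
    ring.
  - intros y Hy; unfold phi.
    pose proof (odd_bern_div_sin_decr B hB (S l) y s ltac:(lra) ltac:(lra) ltac:(lra)); lra.
Qed.

(** Here the quotient is bounded by its limit - p_l'(1/2) / (2 pi) at 1/2, where every p_l vanishes,
    [l = 0] included. *)
Lemma odd_bern_lower (B : nat -> R -> R) (hB : is_bernoulli_polynomials B)
  (l : nat) (s : R) :
  0 < s < 1 / 2 ->
  - even_bern B l (1 / 2) * sin (2 * PI * s) <= 2 * PI * odd_bern B l s.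
Proof.
  intros Hs.
  pose (phi := fun y => odd_bern B l s * sin (2 * PI * y)
                        - sin (2 * PI * s) * odd_bern B l y).
  enough (odd_bern B l s * (2 * PI * cos (2 * PI * (1 / 2)))
          - sin (2 * PI * s) * even_bern B l (1 / 2) <= 0) as H.
  { rewrite cos_2PI_half in H; lra. }
  apply (is_derive_le_0_left phi s (1 / 2)); [lra| | |].
  - apply (is_derive_minus (V := R_NormedModule)); apply is_derive_scal.
    + apply is_derive_sin_2PI.
    + now apply odd_bern_derive.
  - unfold phi; rewrite odd_bern_at_half, sin_2PI_half by assumption; ring.
  - intros y Hy; unfold phi.
    pose proof (odd_bern_div_sin_decr B hB l s y ltac:(lra) ltac:(lra) ltac:(lra)); lra.
Qed.

Lemma even_bern_at_0_pos (B : nat -> R -> R) (hB : is_bernoulli_polynomials B) (l : nat) :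
  0 < even_bern B (S l) 0.
Proof.
  pose proof (odd_bern_upper B hB l (1 / 4) ltac:(lra)) as H.
  pose proof (odd_bern_pos B hB (S l) (1 / 4) ltac:(lra)).
  pose proof (sin_2PI_pos (1 / 4) ltac:(lra)).
  pose proof PI_RGT_0.
  assert (0 < 2 * PI * odd_bern B (S l) (1 / 4)) by (apply Rmult_lt_0_compat; lra).
  nra.
Qed.

(** This is [odd_bern_upper] integrated from 0 to [s], since p_(l+2)'' = - p_(l+1). The endpoint 1/2
    is included because the ratio of consecutive values at 0 is estimated there. *)
Lemma even_bern_drop_upper (B : nat -> R -> R) (hB : is_bernoulli_polynomials B)
  (l : nat) (s : R) :
  0 < s <= 1 / 2 ->
  (2 * PI) ^ 2 * (even_bern B (S (S l)) 0 - even_bern B (S (S l)) s)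
  <= even_bern B (S l) 0 * (1 - cos (2 * PI * s)).
Proof.
  intros Hs; pose proof PI_RGT_0.
  (* [phi 0 - phi s] is [2 * PI] times the right side minus the left side, and [phi' <= 0] is the
     bound being integrated. *)
  pose (phi := fun y => even_bern B (S l) 0 * (2 * PI * cos (2 * PI * y))
                        - 2 * PI * ((2 * PI) ^ 2 * even_bern B (S (S l)) y)).
  assert (H1 : phi s <= phi 0).
  { apply is_derive_nonpos_le with
      (fun y => even_bern B (S l) 0 * (- ((2 * PI) ^ 2 * sin (2 * PI * y)))
                - 2 * PI * ((2 * PI) ^ 2 * - odd_bern B (S l) y)); [lra| |].
    - intros y _; apply (is_derive_minus (V := R_NormedModule)).
      + apply is_derive_scal, is_derive_cos_2PI.
      + now apply is_derive_scal, is_derive_scal, even_bern_derive.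
    - intros y Hy; pose proof (odd_bern_upper B hB l y ltac:(lra)).
      assert (0 < (2 * PI) ^ 2) by (apply pow_lt; lra); nra. }
  unfold phi in H1; rewrite (Rmult_0_r (2 * PI)), cos_0 in H1.
  apply Rmult_le_reg_l with (2 * PI); lra.
Qed.

Lemma even_bern_drop_lower (B : nat -> R -> R) (hB : is_bernoulli_polynomials B)
  (l : nat) (s : R) :
  0 < s <= 1 / 2 ->
  - even_bern B l (1 / 2) * (1 - cos (2 * PI * s))
  <= (2 * PI) ^ 2 * (even_bern B (S l) 0 - even_bern B (S l) s).
Proof.
  intros Hs; pose proof PI_RGT_0.
  pose (phi := fun y => 2 * PI * ((2 * PI) ^ 2 * even_bern B (S l) y)
                        - - even_bern B l (1 / 2) * (2 * PI * cos (2 * PI * y))).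
  assert (H1 : phi s <= phi 0).
  { apply is_derive_nonpos_le with
      (fun y => 2 * PI * ((2 * PI) ^ 2 * - odd_bern B l y)
         - - even_bern B l (1 / 2) * (- ((2 * PI) ^ 2 * sin (2 * PI * y)))); [lra| |].
    - intros y _; apply (is_derive_minus (V := R_NormedModule)).
      + now apply is_derive_scal, is_derive_scal, even_bern_derive.
      + apply is_derive_scal, is_derive_cos_2PI.
    - intros y Hy; pose proof (odd_bern_lower B hB l y ltac:(lra)).
      assert (0 < (2 * PI) ^ 2) by (apply pow_lt; lra); nra. }
  unfold phi in H1; rewrite (Rmult_0_r (2 * PI)), cos_0 in H1.
  apply Rmult_le_reg_l with (2 * PI); lra.
Qed.

(** * The ratios as logarithmic derivatives p_l' / p_l, and their monotonicity *)

Lemma odd_bern_neq_0 (B : nat -> R -> R) (hB : is_bernoulli_polynomials B)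
  (l : nat) (s : R) :
  0 < s < 1 -> s <> 1 / 2 -> odd_bern B l s <> 0.
Proof.
  intros Hs Hs2; destruct (Rlt_le_dec s (1 / 2)).
  - pose proof (odd_bern_pos B hB l s ltac:(lra)); lra.
  - pose proof (odd_bern_pos B hB l (1 - s) ltac:(lra)) as H.
    rewrite odd_bern_symm in H by assumption; lra.
Qed.

Lemma bernoulli_odd_neq_0 (B : nat -> R -> R) (l : nat) (s : R) :
  odd_bern B l s <> 0 -> B (2 * l + 1)%nat s <> 0.
Proof.
  intros H E; apply H; unfold odd_bern, bern; rewrite E; unfold Rdiv; ring.
Qed.

Lemma scaled_bernoulli_ratioE (B : nat -> R -> R) (l : nat) (s : R) :
  odd_bern B l s <> 0 ->
  scaled_bernoulli_ratio B s l = even_bern B l s / odd_bern B l s.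
Proof.
  intros H; pose proof (bernoulli_odd_neq_0 B l s H).
  unfold scaled_bernoulli_ratio, odd_bern, even_bern, bern.
  replace (fact (2 * l + 1)) with ((2 * l + 1) * fact (2 * l))%nat
    by now rewrite Nat.add_1_r.
  assert ((-1) ^ S l <> 0) by (apply pow_nonzero; lra).
  assert (INR (2 * l + 1) <> 0) by (apply not_0_INR; lia).
  pose proof (INR_fact_neq_0 (2 * l)).
  rewrite mult_INR; field; auto.
Qed.

Lemma bernoulli_ratioE (B : nat -> R -> R) (l : nat) (s : R) :
  odd_bern B l s <> 0 ->
  bernoulli_ratio B l s = even_bern B l s / odd_bern B l s / INR (2 * l + 1).
Proof.
  intros H; rewrite <- scaled_bernoulli_ratioE by assumption.
  unfold bernoulli_ratio, scaled_bernoulli_ratio; field.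
  split; [now apply bernoulli_odd_neq_0|apply not_0_INR; lia].
Qed.

(** Under reflection in 1/2, p_l is odd and p_l' is even. *)
Lemma ratio_symm (B : nat -> R -> R) (hB : is_bernoulli_polynomials B) (l : nat) (s : R) :
  even_bern B l (1 - s) / odd_bern B l (1 - s) = - (even_bern B l s / odd_bern B l s).
Proof.
  rewrite odd_bern_symm, even_bern_symm by assumption.
  unfold Rdiv; rewrite Rinv_opp; ring.
Qed.

(** For positive index the numerator of the derivative is p'' p - p'^2 with p'' = - p_(l-1) < 0. For
    index 0 the ratio is - 1 / p_0 with p_0 decreasing. *)
Lemma ratio_decr_left (B : nat -> R -> R) (hB : is_bernoulli_polynomials B) (l : nat) :
  strictly_decreasing_on (fun s => even_bern B l s / odd_bern B l s) 0 (1 / 2).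
Proof.
  intros x y Hx Hxy Hy.
  assert (Hpos : forall s, x <= s <= y -> 0 < odd_bern B l s)
    by (intros; apply odd_bern_pos; trivial; lra).
  destruct l as [|l].
  - rewrite !even_bern_0 by assumption.
    assert (odd_bern B 0 y < odd_bern B 0 x).
    { apply is_derive_neg_lt with (even_bern B 0); trivial.
      - intros s _; now apply odd_bern_derive.
      - intros s _; rewrite even_bern_0 by assumption; lra. }
    assert (/ odd_bern B 0 x < / odd_bern B 0 y).
    { apply Rinv_lt_contravar; trivial.
      apply Rmult_lt_0_compat; apply Hpos; lra. }
    unfold Rdiv; lra.
  - apply (is_derive_neg_lt (fun s => even_bern B (S l) s / odd_bern B (S l) s)
      (fun s => (- odd_bern B l s * odd_bern B (S l) s
                 - even_bern B (S l) s * even_bern B (S l) s) / odd_bern B (S l) s ^ 2));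
      trivial.
    + intros s Hs; specialize (Hpos s Hs).
      apply is_derive_div; [now apply even_bern_derive|now apply odd_bern_derive|lra].
    + intros s Hs; specialize (Hpos s ltac:(lra)).
      pose proof (odd_bern_pos B hB l s ltac:(lra)).
      apply Rdiv_neg_pos; [nra|now apply pow_lt].
Qed.

Lemma ratio_incr_index (B : nat -> R -> R) (hB : is_bernoulli_polynomials B)
  (l : nat) (s : R) :
  0 < s < 1 / 2 ->
  even_bern B l s / odd_bern B l s < even_bern B (S l) s / odd_bern B (S l) s.
Proof.
  intros Hs.
  pose proof (odd_bern_pos B hB l s Hs).
  pose proof (odd_bern_pos B hB (S l) s Hs).
  pose proof (odd_bern_wronskian_pos B hB l s Hs).
  apply Rlt_0_minus.
  replace (_ - _) with
    ((even_bern B (S l) s * odd_bern B l s - odd_bern B (S l) s * even_bern B l s)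
     / (odd_bern B l s * odd_bern B (S l) s)) by (field; lra).
  apply Rdiv_lt_0_compat; [lra|now apply Rmult_lt_0_compat].
Qed.

(** * Quantitative squeeze and the limit in l *)

Lemma even_bern_0_ratio_bounds (B : nat -> R -> R) (hB : is_bernoulli_polynomials B)
  (l : nat) :
  let e := 2 * (1 / 4) ^ S l in
  let rho := even_bern B (S l) 0 / ((2 * PI) ^ 2 * even_bern B (S (S l)) 0) in
  1 - e <= rho /\ (1 - e) * rho <= 1.
Proof.
  intros e rho.
  assert (H2 : even_bern B (S (S l)) (1 / 2) = _) by now apply even_bern_at_half.
  assert (H1 : even_bern B (S l) (1 / 2) = _) by now apply even_bern_at_half.
  (* At [s = 1/2] one has 1 - cos = 2, and the values at 1/2 are known multiples of those at 0, so
     both drop estimates become bounds on [rho]. *)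
  pose proof (even_bern_drop_upper B hB l (1 / 2) ltac:(lra)) as U.
  pose proof (even_bern_drop_lower B hB (S l) (1 / 2) ltac:(lra)) as L.
  pose proof (even_bern_at_0_pos B hB l) as P1.
  pose proof (even_bern_at_0_pos B hB (S l)) as P2.
  rewrite cos_2PI_half, H2 in U; rewrite cos_2PI_half, H1, H2 in L.
  change ((1 / 4) ^ S (S l)) with (1 / 4 * (1 / 4) ^ S l) in U, L.
  assert (He : 0 < (1 / 4) ^ S l) by (apply pow_lt; lra).
  assert (Hpi : 0 < (2 * PI) ^ 2) by (apply pow_lt; pose proof PI_RGT_0; lra).
  set (q := (1 / 4) ^ S l) in *.
  set (a := even_bern B (S l) 0) in *.
  set (a' := (2 * PI) ^ 2 * even_bern B (S (S l)) 0) in *.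
  assert (Ha' : 0 < a') by now apply Rmult_lt_0_compat.
  replace ((2 * PI) ^ 2 * (_ - _)) with (a' * (2 - 2 * (1 / 4 * q))) in U, L
    by (unfold a'; ring).
  assert (Er : a = rho * a') by (unfold rho; field; lra).
  rewrite Er in U, L; unfold e.
  (* The estimates give [rho >= 1 - q / 4] and [(1 - e) * rho <= 1 - q / 4] with [e = 2 * q]; both
     are weakened to the stated form. *)
  split; apply Rmult_le_reg_r with a'; trivial; nra.
Qed.

(** Normalizing by [a] = p_(l+2)'(0) makes all bounds depend on [l] only through [e], which tends to
    0; they close in on cos (2 pi s) and sin (2 pi s). *)
Lemma odd_even_bern_bounds (B : nat -> R -> R) (hB : is_bernoulli_polynomials B)
  (s : R) (l : nat) :
  0 < s < 1 / 2 ->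
  let e := 2 * (1 / 4) ^ S l in
  let a := even_bern B (S (S l)) 0 in
  let c := 1 - cos (2 * PI * s) in
  1 - / (1 - e) * c <= even_bern B (S (S l)) s / a <= 1 - (1 - e) * (1 - e) * c /\
  (1 - e) * sin (2 * PI * s) <= 2 * PI * (odd_bern B (S (S l)) s / a)
    <= sin (2 * PI * s).
Proof.
  intros Hs e a c.
  destruct (even_bern_0_ratio_bounds B hB l) as [R1 R2].
  fold e a in R1, R2.
  assert (H2 : even_bern B (S (S l)) (1 / 2) = _) by now apply even_bern_at_half.
  assert (H1 : even_bern B (S l) (1 / 2) = _) by now apply even_bern_at_half.
  pose proof (even_bern_drop_upper B hB l s ltac:(lra)) as U.
  pose proof (even_bern_drop_lower B hB (S l) s ltac:(lra)) as L.
  pose proof (odd_bern_upper B hB (S l) s Hs) as U'.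
  pose proof (odd_bern_lower B hB (S (S l)) s Hs) as L'.
  pose proof (even_bern_at_0_pos B hB (S l)) as Pa.
  pose proof (sin_2PI_pos s Hs) as Sp.
  pose proof PI_RGT_0.
  assert (Hpi : 0 < (2 * PI) ^ 2) by (apply pow_lt; lra).
  assert (Hc : 0 <= c) by (unfold c; pose proof (COS_bound (2 * PI * s)); lra).
  (* The exponent [S l] keeps [e] at most 1/2 even for [l = 0], so [1 - e] is positive and may be
     inverted. *)
  assert (He : 0 < (1 / 4) ^ S l <= 1 / 4).
  { split; [apply pow_lt; lra|]. simpl.
    pose proof (pow_incr (1 / 4) 1 l ltac:(lra)) as Hq; rewrite pow1 in Hq; lra. }
  assert (He' : 0 < e <= 1 / 2) by (unfold e; lra).
  rewrite H1 in L; rewrite H2 in L'.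
  change ((1 / 4) ^ S (S l)) with (1 / 4 * (1 / 4) ^ S l) in L'.
  fold e a c in U, L, U', L', Pa.
  (* The sine bound at index [l + 2] has the smaller error [e / 4], later weakened to [e] so that
     one error term serves everywhere. *)
  replace (2 * (1 / 4 * (1 / 4) ^ S l)) with (e / 4) in L' by (unfold e; field).
  set (x := even_bern B (S (S l)) s) in *; set (p := odd_bern B (S (S l)) s) in *.
  set (b := even_bern B (S l) 0) in *.
  set (rho := b / ((2 * PI) ^ 2 * a)) in *.
  assert (Ex : x = x / a * a) by (field; lra).
  assert (Ep : p = p / a * a) by (field; lra).
  assert (Eb : b = rho * ((2 * PI) ^ 2 * a)) by (unfold rho; field; lra).
  set (u := x / a) in *; set (v := p / a) in *; clearbody u v rho x p.
  rewrite Ex, Eb in U, L; rewrite Ep in U', L'.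
  assert (Pk : 0 < (2 * PI) ^ 2 * a) by now apply Rmult_lt_0_compat.
  assert (U1 : 1 - u <= rho * c)
    by (apply Rmult_le_reg_l with ((2 * PI) ^ 2 * a); trivial; lra).
  assert (L1 : (1 - e) * rho * c <= 1 - u)
    by (apply Rmult_le_reg_l with ((2 * PI) ^ 2 * a); trivial; lra).
  assert (U2 : 2 * PI * v <= sin (2 * PI * s))
    by (apply Rmult_le_reg_l with a; trivial; lra).
  assert (L2 : (1 - e / 4) * sin (2 * PI * s) <= 2 * PI * v)
    by (apply Rmult_le_reg_l with a; trivial; lra).
  assert (R3 : rho <= / (1 - e)).
  { apply Rmult_le_reg_l with (1 - e); [lra|rewrite Rinv_r; lra]. }
  repeat split; trivial.
  - assert (rho * c <= / (1 - e) * c) by now apply Rmult_le_compat_r. lra.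
  - assert ((1 - e) * (1 - e) * c <= (1 - e) * rho * c).
    { apply Rmult_le_compat_r; trivial; apply Rmult_le_compat_l; lra. }
    lra.
  - nra.
Qed.

Lemma is_lim_seq_ratio (B : nat -> R -> R) (hB : is_bernoulli_polynomials B) (s : R) :
  0 < s < 1 / 2 ->
  is_lim_seq (fun l => even_bern B l s / odd_bern B l s)
    (2 * PI * cot (2 * PI * s)).
Proof.
  (* The bounds start at index 2, so the first two terms are dropped. *)
  intros Hs; apply is_lim_seq_incr_1, is_lim_seq_incr_1.
  pose proof (sin_2PI_pos s Hs) as Sp; pose proof PI_RGT_0.
  pose (e := fun l : nat => 2 * (1 / 4) ^ S l).
  assert (He : is_lim_seq e 0).
  { unfold e; replace (Finite 0) with (Rbar_mult 2 0) by (simpl; f_equal; ring).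
    apply is_lim_seq_scal_l; apply (is_lim_seq_incr_1 (fun l => (1 / 4) ^ l)).
    apply is_lim_seq_geom; rewrite Rabs_pos_eq; lra. }
  assert (He1 : is_lim_seq (fun l => 1 - e l) 1).
  { rewrite <- (Rminus_0_r 1) at 1.
    now apply is_lim_seq_minus'; [apply is_lim_seq_const|]. }
  pose (c := 1 - cos (2 * PI * s)).
  assert (Hu : is_lim_seq
    (fun l => even_bern B (S (S l)) s / even_bern B (S (S l)) 0) (1 - c)).
  { apply is_lim_seq_le_le with (fun l => 1 - / (1 - e l) * c)
      (fun l => 1 - (1 - e l) * (1 - e l) * c).
    - intros l; apply (odd_even_bern_bounds B hB s l Hs).
    - replace (1 - c) with (1 - / 1 * c) by field.
      apply is_lim_seq_minus'; [apply is_lim_seq_const|].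
      apply is_lim_seq_mult'; [|apply is_lim_seq_const].
      apply (is_lim_seq_inv _ 1); trivial; intros E; injection E; lra.
    - replace (1 - c) with (1 - 1 * 1 * c) by field.
      apply is_lim_seq_minus'; [apply is_lim_seq_const|].
      apply is_lim_seq_mult'; [|apply is_lim_seq_const].
      now apply is_lim_seq_mult'. }
  assert (Hv : is_lim_seq
    (fun l => 2 * PI * (odd_bern B (S (S l)) s / even_bern B (S (S l)) 0))
    (sin (2 * PI * s))).
  { apply is_lim_seq_le_le with (fun l => (1 - e l) * sin (2 * PI * s))
      (fun _ => sin (2 * PI * s)).
    - intros l; apply (odd_even_bern_bounds B hB s l Hs).
    - rewrite <- (Rmult_1_l (sin (2 * PI * s))) at 1.
      apply is_lim_seq_mult'; trivial; apply is_lim_seq_const.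
    - apply is_lim_seq_const. }
  replace (2 * PI * cot (2 * PI * s)) with (2 * PI * ((1 - c) / sin (2 * PI * s)))
    by (unfold c, cot; field; lra).
  (* Numerator and denominator share the normalization by p_(l+2)'(0), which cancels in the
     quotient. *)
  eapply is_lim_seq_ext; cycle 1.
  - apply is_lim_seq_mult'; [apply is_lim_seq_const|].
    apply is_lim_seq_div'; [exact Hu|exact Hv|lra].
  - intros l; simpl.
    pose proof (even_bern_at_0_pos B hB (S l)).
    pose proof (odd_bern_pos B hB (S (S l)) s Hs).
    field; repeat split; lra.
Qed.

Theorem theorem4p1 (B : nat -> R -> R) (hB : is_bernoulli_polynomials B) :
  (forall (l : nat) (s : R), 0 < s < 1 -> s <> 1 / 2 ->
     B (2 * l + 1)%nat s <> 0) /\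
  (forall l : nat,
     strictly_decreasing_on (bernoulli_ratio B l) 0 (1 / 2) /\
     strictly_decreasing_on (bernoulli_ratio B l) (1 / 2) 1) /\
  (forall s : R, 0 < s < 1 / 2 ->
     forall l : nat,
       scaled_bernoulli_ratio B s l < scaled_bernoulli_ratio B s (S l)) /\
  (forall s : R, 1 / 2 < s < 1 ->
     forall l : nat,
       scaled_bernoulli_ratio B s (S l) < scaled_bernoulli_ratio B s l) /\
  (forall s : R, 0 < s < 1 -> s <> 1 / 2 ->
     is_lim_seq (scaled_bernoulli_ratio B s)
                (Finite (2 * PI * cot (2 * PI * s)))).
Proof.
  assert (Hneq := odd_bern_neq_0 B hB).
  repeat split.
  (* Nonvanishing denominators make all the ratios genuine quotients rather than default values of
     division. *)
  - intros l s Hs Hs2; now apply bernoulli_odd_neq_0, Hneq.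
  - intros x y Hx Hxy Hy.
    rewrite !bernoulli_ratioE by (apply Hneq; lra).
    apply Rmult_lt_compat_r; [apply Rinv_0_lt_compat, lt_0_INR; lia|].
    now apply (ratio_decr_left B hB l x y).
  - intros x y Hx Hxy Hy.
    rewrite !bernoulli_ratioE by (apply Hneq; lra).
    apply Rmult_lt_compat_r; [apply Rinv_0_lt_compat, lt_0_INR; lia|].
    (* Reflection and negation each reverse the order, so the ratio decreases on [(1/2, 1)] too. *)
    apply Ropp_lt_cancel; rewrite <- !ratio_symm by assumption.
    apply (ratio_decr_left B hB l (1 - y) (1 - x)); lra.
  - intros s Hs l; rewrite !scaled_bernoulli_ratioE by (apply Hneq; lra).
    now apply ratio_incr_index.
  - intros s Hs l; rewrite !scaled_bernoulli_ratioE by (apply Hneq; lra).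
    (* For fixed [s] only the negation acts on the order in [l], so increase becomes decrease. *)
    apply Ropp_lt_cancel; rewrite <- !ratio_symm by assumption.
    apply ratio_incr_index; trivial; lra.
  - intros s Hs Hs2.
    apply is_lim_seq_ext with (fun l => even_bern B l s / odd_bern B l s).
    { intros l; symmetry; apply scaled_bernoulli_ratioE, Hneq; lra. }
    destruct (Rlt_le_dec s (1 / 2)); [apply is_lim_seq_ratio; trivial; lra|].
    (* The limit obeys the same reflection rule as the ratios, the cotangent being odd and 2 pi
       periodic. *)
    replace (2 * PI * cot (2 * PI * s)) with (- (2 * PI * cot (2 * PI * (1 - s)))).
    + apply is_lim_seq_ext with
        (fun l => - (even_bern B l (1 - s) / odd_bern B l (1 - s))).
      { intros l; rewrite ratio_symm by assumption; ring. }
      apply (is_lim_seq_opp _ (2 * PI * cot (2 * PI * (1 - s)))).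
      apply is_lim_seq_ratio; trivial; lra.
    + unfold cot; replace (2 * PI * (1 - s)) with (- (2 * PI * s) + 2 * INR 1 * PI)
        by (simpl; ring).
      rewrite cos_period, sin_period, cos_neg, sin_neg.
      unfold Rdiv; rewrite Rinv_opp; ring.
Qed.
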